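(* Let $w\in\mathbb R^n$ be an $L$-generic direction, $\Lambda\in\mathfrak L_\beta$, and $K\in\mathcal A_w(\Lambda)$. Then the following conditions are equivalent. (1) $v_{\Lambda,K}\in\mathrm{Rexp}_w(\Lambda)$. (2) There exists $(c_{\Lambda,J})_{J\in\mathrm{NS}(\Lambda)}\in\mathrm{Coeff}^{\mathrm{dir}}_w(\Lambda)$ such that $c_{\Lambda,J}=0$ for all $J\in\mathcal A^{<K}_w(\Lambda)$ and $c_{\Lambda,K}\ne0$. (3) $\mathrm{Ker}(\pi_{\Lambda,<K})\not\subset\mathrm{Ker}(\pi_{\Lambda,K})$. Consequently, $$\mathrm{Rexp}_w(\Lambda)=\{v_{\Lambda,K}\mid K\in\mathcal A_w(\Lambda),\ \mathrm{Ker}(\pi_{\Lambda,<K})\not\subset\mathrm{Ker}(\pi_{\Lambda,K})\}.$$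
   Context: Basics. $\mathbb N=\{0,1,2,\dots\}$, $[n]=\{1,\dots,n\}$. $A=(a_{ij})\in\mathrm{Mat}_{d\times n}(\mathbb Z)$ has rank $d$, $\beta\in\mathbb C^d$, $L=\mathrm{Ker}_{\mathbb Z}(A)$. An exponent lattice is a coset $\Lambda=\lambda+L$ with $\lambda\in\mathbb C^n$, $A\lambda=\beta$; $\mathfrak L_\beta$ is the set of all of them. Hypergeometric ideal. $D=\mathbb C\langle x_1,\dots,x_n,\partial_{x_1},\dots,\partial_{x_n}\rangle$ is the Weyl algebra, $\theta_{x_j}=x_j\partial_{x_j}$, $(A\theta_x)_i=\sum_ja_{ij}\theta_{x_j}$. For $u\in\mathbb Z^n$ write $u=u_+-u_-$ with $u_\pm\in\mathbb N^n$ of disjoint support. $I_A=\langle\partial_x^{u_+}-\partial_x^{u_-}\mid u\in L\rangle\subset\mathbb C[\partial_x]$, $H_A(\beta)=DI_A+\sum_{i=1}^dD((A\theta_x)_i-\beta_i)$. Formal series. $S=\mathbb C[\partial_{y_1},\dots,\partial_{y_n}]$ acts on $\mathbb C[y]$ by differentiation, written $\bullet$; $(A\partial_y)_i=\sum_ja_{ij}\partial_{y_j}$; $\partial_y^K=\prod_{j\in K}\partial_{y_j}$. $\widetilde\Lambda=\Lambda+\mathbb Z^n$. $\mathscr F^{\log}_{\widetilde\Lambda}$ is the space of all formal (possibly infinite) sums $\sum_{\gamma\in\widetilde\Lambda}x^\gamma p_\gamma(\log x)$, $p_\gamma\in\mathbb C[y]$, with coefficientwise equality, on which $D$ acts coefficientwise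 by $x_j\bullet(x^\gamma p(\log x))=x^{\gamma+e_j}p(\log x)$, $\partial_{x_j}\bullet(x^\gamma p(\log x))=x^{\gamma-e_j}((\gamma_j+\partial_{y_j})\bullet p)(\log x)$. $\mathrm{Supp}(\varphi)=\{\gamma\mid p_\gamma\ne0\}$. Supports and direction. $\mathrm{nsupp}(\gamma)=\{j\in[n]\mid\gamma_j\in\mathbb Z_{<0}\}$; $\Lambda_I=\{\gamma\in\Lambda\mid\mathrm{nsupp}(\gamma)=I\}$; $\mathrm{NS}(\Lambda)=\{I\mid\Lambda_I\ne\emptyset\}$. $w$ is $L$-generic if $w\cdot u\ne0$ for all $u\in L\setminus\{0\}$. On $\Lambda$, $\gamma\le_w\gamma'$ iff $w\cdot(\gamma'-\gamma)\ge0$ (a total order). $\mathcal B_w(\Lambda)$ is the set of $I\in\mathrm{NS}(\Lambda)$ such that $\{w\cdot(\gamma-\lambda)\mid\gamma\in\Lambda_I\}$ is bounded below in $\mathbb R$ (for one, equivalently any, $\lambda\in\Lambda$); for $I\in\mathcal B_w(\Lambda)$, $v_{\Lambda,I}$ is the (existing, unique) $\le_w$-minimum of $\Lambda_I$. $\mathcal A_w(\Lambda)$ is the set of $I\in\mathrm{NS}(\Lambda)$ such that every $J\in\mathrm{NS}(\Lambda)$ with $J\subset I$ lies in $\mathcal B_w(\Lambda)$; thus $\mathcal A_w(\Lambda)\subset\mathcal B_w(\Lambda)$. Solutions. $\mathrm{Sol}^{\mathrm{dir}}_{w,\Lambda}(H_A(\beta))$ is the set of $\varphi\in\mathscr F^{\log}_{\widetilde\Lambda}$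 with $\mathrm{Supp}(\varphi)\subset\Lambda$ and $H_A(\beta)\bullet\varphi=0$ such that $\varphi=0$ or $\mathrm{Supp}(\varphi)$ has a $\le_w$-minimum; for $\varphi\ne0$ this minimum is $\mathrm{lexp}_w(\varphi)$. $\mathrm{Rexp}_w(\Lambda)=\{\mathrm{lexp}_w(\varphi)\mid0\ne\varphi\in\mathrm{Sol}^{\mathrm{dir}}_{w,\Lambda}(H_A(\beta))\}$. Coefficient space. $\mathrm{Coeff}^{\mathrm{dir}}_w(\Lambda)$ is the space of families $(c_{\Lambda,I})_{I\in\mathrm{NS}(\Lambda)}$ in $\mathbb C[y]$ with $(A\partial_y)_i\bullet c_{\Lambda,I}=0$ for all $I,i$; $\partial_y^{J\setminus I}\bullet c_{\Lambda,I}=\partial_y^{I\setminus J}\bullet c_{\Lambda,J}$ for all $I,J\in\mathrm{NS}(\Lambda)$; and $c_{\Lambda,I}=0$ for $I\in\mathrm{NS}(\Lambda)\setminus\mathcal A_w(\Lambda)$. For $K\in\mathcal A_w(\Lambda)$: $\pi_{\Lambda,K}:\mathrm{Coeff}^{\mathrm{dir}}_w(\Lambda)\to\mathbb C[y]$, $(c_{\Lambda,J})_J\mapsto c_{\Lambda,K}$; $\mathcal A^{<K}_w(\Lambda)=\{J\in\mathcal A_w(\Lambda)\mid v_{\Lambda,J}<_wv_{\Lambda,K}\}$; $\pi_{\Lambda,<K}=\bigoplus_{J\in\mathcal A^{<K}_w(\Lambda)}\pi_{\Lambda,J}$ is the map recording all components indexed by $\mathcal A^{<K}_w(\Lambda)$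 (the zero map to the zero space if this set is empty). *)

(* Defs.v *)
From HB Require Import structures.
From mathcomp Require Import all_boot all_order all_algebra.
From mathcomp Require Import generic_quotient.
From mathcomp Require Import mpoly.
From mathcomp Require Import complex.
From mathcomp Require Import boolp classical_sets functions reals.

Set Implicit Arguments.
Unset Strict Implicit.
Unset Printing Implicit Defensive.

Import Order.TTheory GRing.Theory Num.Theory.

Local Open Scope classical_set_scope.
Local Open Scope ring_scope.
Local Open Scope quotient_scope.
Local Open Scope complex_scope.

(** The Weyl algebra [weyl K n] is the free associative K-algebra on
    x_1, .., x_n, d_1, .., d_n modulo the relations [x_i, x_j] = [d_i, d_j] = 0
    and [d_i, x_j] = delta_ij. It is built as expressions modulo the congruence
    generated by the K-algebra axioms and these relations. *)

Inductive weyl_expr (K : Type) (n : nat) : Type :=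
| WConst of K
| WX of 'I_n
| WD of 'I_n
| WAdd of weyl_expr K n & weyl_expr K n
| WMul of weyl_expr K n & weyl_expr K n.

Arguments WConst {K n}.
Arguments WX {K n}.
Arguments WD {K n}.

HB.instance Definition _ (K : Type) (n : nat) := gen_eqMixin (weyl_expr K n).
HB.instance Definition _ (K : Type) (n : nat) :=
  gen_choiceMixin (weyl_expr K n).

Inductive weyl_cong (K : comNzRingType) (n : nat) :
  weyl_expr K n -> weyl_expr K n -> Prop :=
| wc_refl s : weyl_cong s s
| wc_sym s t : weyl_cong s t -> weyl_cong t s
| wc_trans s t u : weyl_cong s t -> weyl_cong t u -> weyl_cong s u
| wc_add s s' t t' : weyl_cong s s' -> weyl_cong t t' ->
    weyl_cong (WAdd s t) (WAdd s' t')
| wc_mul s s' t t' : weyl_cong s s' -> weyl_cong t t' ->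
    weyl_cong (WMul s t) (WMul s' t')
| wc_addA s t u : weyl_cong (WAdd s (WAdd t u)) (WAdd (WAdd s t) u)
| wc_addC s t : weyl_cong (WAdd s t) (WAdd t s)
| wc_add0 s : weyl_cong (WAdd (WConst 0) s) s
| wc_addN s : weyl_cong (WAdd (WMul (WConst (-1)) s) s) (WConst 0)
| wc_mulA s t u : weyl_cong (WMul s (WMul t u)) (WMul (WMul s t) u)
| wc_mul1l s : weyl_cong (WMul (WConst 1) s) s
| wc_mul1r s : weyl_cong (WMul s (WConst 1)) s
| wc_mulDl s t u :
    weyl_cong (WMul (WAdd s t) u) (WAdd (WMul s u) (WMul t u))
| wc_mulDr s t u :
    weyl_cong (WMul s (WAdd t u)) (WAdd (WMul s t) (WMul s u))
| wc_constD a b : weyl_cong (WAdd (WConst a) (WConst b)) (WConst (a + b))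
| wc_constM a b : weyl_cong (WMul (WConst a) (WConst b)) (WConst (a * b))
| wc_constC a s : weyl_cong (WMul (WConst a) s) (WMul s (WConst a))
| wc_XX i j : weyl_cong (WMul (WX i) (WX j)) (WMul (WX j) (WX i))
| wc_DD i j : weyl_cong (WMul (WD i) (WD j)) (WMul (WD j) (WD i))
| wc_DX i j : weyl_cong (WMul (WD i) (WX j))
    (WAdd (WMul (WX j) (WD i)) (WConst (i == j)%:R)).

(** Formal sums of the terms x^g p_g(log x), g in K^n: [phi g] is the
    polynomial p_g. All exponents in K^n are allowed here; the exponent set is
    restricted in [flog_space]. *)
Definition flog (K : comNzRingType) (n : nat) := 'cV[K]_n -> {mpoly K[n]}.

HB.instance Definition _ (K : comNzRingType) (n : nat) :=
  GRing.Lmodule.on (flog K n).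

Definition basis_vec (K : comNzRingType) (n : nat) (j : 'I_n) : 'cV[K]_n :=
  delta_mx j 0.

(** The coefficient at [g] of x_j . phi comes from the exponent [g - e_j], that
    of d_j . phi from the exponent [g + e_j]. *)
Definition flogX (K : comNzRingType) (n : nat) (j : 'I_n) (phi : flog K n) :
  flog K n := fun g => phi (g - basis_vec K j).

Definition flogD (K : comNzRingType) (n : nat) (j : 'I_n) (phi : flog K n) :
  flog K n :=
  fun g => let g' := g + basis_vec K j in
    g' j 0 *: phi g' + (phi g')^`M(j).

Fixpoint expr_act (K : comNzRingType) (n : nat) (s : weyl_expr K n)
    (phi : flog K n) : flog K n :=
  match s with
  | WConst a => a *: phi
  | WX j => flogX j phi
  | WD j => flogD j phi
  | WAdd s t => expr_act s phi + expr_act t phi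
  | WMul s t => expr_act s (expr_act t phi)
  end.

Section WeylAlgebra.
Variables (K : comNzRingType) (n : nat).
Implicit Types (s t u : weyl_expr K n) (phi psi : flog K n) (a b : K).

Lemma flogX_linear j a phi psi :
  flogX j (a *: phi + psi) = a *: flogX j phi + flogX j psi.
Proof. by []. Qed.

Lemma flogD_linear j a phi psi :
  flogD j (a *: phi + psi) = a *: flogD j phi + flogD j psi.
Proof.
apply: funext => g; rewrite /flogD /= !fctE.
rewrite mderivD mderivZ !scalerDr !scalerA [in LHS](mulrC _ a).
by rewrite addrACA.
Qed.

Lemma expr_act_linear s a phi psi :
  expr_act s (a *: phi + psi) = a *: expr_act s phi + expr_act s psi.
Proof.
elim: s phi psi => [b|j|j|s IHs t IHt|s IHs t IHt] phi psi /=.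
- by rewrite scalerDr !scalerA mulrC.
- exact: flogX_linear.
- exact: flogD_linear.
- by rewrite IHs IHt scalerDr addrACA.
- by rewrite IHt IHs.
Qed.

Lemma expr_actD s phi psi :
  expr_act s (phi + psi) = expr_act s phi + expr_act s psi.
Proof. by have := expr_act_linear s 1 phi psi; rewrite !scale1r. Qed.

Lemma expr_act0 s : expr_act s 0 = 0 :> flog K n.
Proof.
by have := expr_act_linear s (-1) 0 0; rewrite scaler0 addr0 scaleN1r addNr.
Qed.

Lemma expr_actZ s a phi : expr_act s (a *: phi) = a *: expr_act s phi.
Proof. by have := expr_act_linear s a phi 0; rewrite expr_act0 !addr0. Qed.

Lemma basis_vecE (i j : 'I_n) :
  basis_vec K i j 0 = (i == j)%:R.
Proof. by rewrite /basis_vec mxE eqxx andbT eq_sym. Qed.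

Lemma flogDD i j phi : flogD i (flogD j phi) = flogD j (flogD i phi).
Proof.
apply: funext => g; rewrite /flogD /= !mderivD !mderivZ !scalerDr !scalerA.
rewrite !mxE !eqxx !andbT (addrAC g) (mderiv_comm i j) (eq_sym j i).
case: eqVneq => [->|_] //; rewrite !addr0 [X in X *: _ + _ + _]mulrC.
by rewrite !addrA; congr (_ + _); rewrite -!addrA; congr (_ + _); apply: addrC.
Qed.

Lemma flogDX i j phi :
  flogD i (flogX j phi) = flogX j (flogD i phi) + (i == j)%:R *: phi.
Proof.
apply: funext => g; rewrite /flogD /flogX !fctE (addrAC g).
set h := g - _ + _; rewrite -addrA (addrC _ (_ *: phi g)) addrA.
congr (_ + _).
have -> : (g + basis_vec K i) i 0 = h i 0 + (i == j)%:R.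
  by rewrite /h !mxE !eqxx !andbT addrAC subrK.
rewrite scalerDl; congr (_ + _); rewrite /h.
by case: eqVneq => [->|]; rewrite ?scale0r // subrK.
Qed.

Lemma expr_act_cong s t phi : weyl_cong s t -> expr_act s phi = expr_act t phi.
Proof.
move=> st; elim: st phi => {s t} //=.
- by move=> s t u _ IH1 _ IH2 phi; rewrite IH1.
- by move=> s s' t t' _ IH1 _ IH2 phi; rewrite IH1 IH2.
- by move=> s s' t t' _ IH1 _ IH2 phi; rewrite IH2 IH1.
- by move=> s t u phi; rewrite addrA.
- by move=> s t phi; rewrite addrC.
- by move=> s phi; rewrite scale0r add0r.
- by move=> s phi; rewrite scaleN1r addNr scale0r.
- by move=> s phi; rewrite scale1r.
- by move=> s phi; rewrite scale1r.
- by move=> s t u phi; rewrite expr_actD.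
- by move=> a b phi; rewrite scalerDl.
- by move=> a b phi; rewrite scalerA.
- by move=> a s phi; rewrite expr_actZ.
- by move=> i j phi; apply: funext => g; rewrite /flogX addrAC.
- by move=> i j phi; rewrite flogDD.
- by move=> i j phi; rewrite flogDX.
Qed.

Definition weyl_equiv s t : bool := `[< weyl_cong s t >].

Lemma weyl_equivP s t : reflect (weyl_cong s t) (weyl_equiv s t).
Proof. exact: asboolP. Qed.

Lemma weyl_equiv_refl : reflexive weyl_equiv.
Proof. by move=> s; apply/weyl_equivP/wc_refl. Qed.

Lemma weyl_equiv_sym : ssrbool.symmetric weyl_equiv.
Proof. by move=> s t; apply/weyl_equivP/weyl_equivP; apply: wc_sym. Qed.

Lemma weyl_equiv_trans : transitive weyl_equiv.
Proof.
by move=> t s u /weyl_equivP st /weyl_equivP tu; apply/weyl_equivP/(wc_trans st).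
Qed.

Canonical weyl_equiv_rel :=
  EquivRel weyl_equiv weyl_equiv_refl weyl_equiv_sym weyl_equiv_trans.

Definition weyl := {eq_quot weyl_equiv}.

HB.instance Definition _ := Choice.on weyl.
HB.instance Definition _ := Quotient.on weyl.
Definition weyl_of_expr s : weyl := \pi_weyl s.

Lemma weyl_of_exprP s t : weyl_of_expr s = weyl_of_expr t <-> weyl_cong s t.
Proof.
by split=> [/eqmodP/weyl_equivP|st]; last exact/eqmodP/weyl_equivP.
Qed.

Lemma weyl_reprK (P : weyl) : weyl_of_expr (repr P) = P.
Proof. exact: reprK. Qed.

Lemma weyl_repr_pi s : weyl_cong (repr (weyl_of_expr s)) s.
Proof. by apply/weyl_of_exprP; rewrite weyl_reprK. Qed.

Definition weyl_zero := weyl_of_expr (WConst 0).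
Definition weyl_one := weyl_of_expr (WConst 1).
Definition weyl_add (P Q : weyl) := weyl_of_expr (WAdd (repr P) (repr Q)).
Definition weyl_mul (P Q : weyl) := weyl_of_expr (WMul (repr P) (repr Q)).
Definition weyl_scale a (P : weyl) := weyl_of_expr (WMul (WConst a) (repr P)).
Definition weyl_opp := weyl_scale (-1).

Lemma weyl_of_exprD s t :
  weyl_add (weyl_of_expr s) (weyl_of_expr t) = weyl_of_expr (WAdd s t).
Proof. by apply/weyl_of_exprP/wc_add; apply: weyl_repr_pi. Qed.

Lemma weyl_of_exprM s t :
  weyl_mul (weyl_of_expr s) (weyl_of_expr t) = weyl_of_expr (WMul s t).
Proof. by apply/weyl_of_exprP/wc_mul; apply: weyl_repr_pi. Qed.

Lemma weyl_of_exprZ a s :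
  weyl_scale a (weyl_of_expr s) = weyl_of_expr (WMul (WConst a) s).
Proof.
by apply/weyl_of_exprP/wc_mul; [exact: wc_refl | exact: weyl_repr_pi].
Qed.

Definition weyl_of_exprE :=
  (weyl_of_exprD, weyl_of_exprM, weyl_of_exprZ).

Lemma weyl_ind (Pr : weyl -> Prop) :
  (forall s, Pr (weyl_of_expr s)) -> forall P, Pr P.
Proof. by move=> h P; rewrite -(weyl_reprK P). Qed.

Lemma weyl_addA : associative weyl_add.
Proof.
elim/weyl_ind=> s; elim/weyl_ind=> t; elim/weyl_ind=> u.
by rewrite !weyl_of_exprE; apply/weyl_of_exprP/wc_addA.
Qed.

Lemma weyl_addC : commutative weyl_add.
Proof.
elim/weyl_ind=> s; elim/weyl_ind=> t.
by rewrite !weyl_of_exprE; apply/weyl_of_exprP/wc_addC.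
Qed.

Lemma weyl_add0 : left_id weyl_zero weyl_add.
Proof.
by elim/weyl_ind=> s; rewrite !weyl_of_exprE; apply/weyl_of_exprP/wc_add0.
Qed.

Lemma weyl_addN : left_inverse weyl_zero weyl_opp weyl_add.
Proof.
elim/weyl_ind=> s; rewrite /weyl_opp !weyl_of_exprE.
exact/weyl_of_exprP/wc_addN.
Qed.

Lemma weyl_mulA : associative weyl_mul.
Proof.
elim/weyl_ind=> s; elim/weyl_ind=> t; elim/weyl_ind=> u.
by rewrite !weyl_of_exprE; apply/weyl_of_exprP/wc_mulA.
Qed.

Lemma weyl_mul1l : left_id weyl_one weyl_mul.
Proof.
by elim/weyl_ind=> s; rewrite !weyl_of_exprE; apply/weyl_of_exprP/wc_mul1l.
Qed.

Lemma weyl_mul1r : right_id weyl_one weyl_mul.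
Proof.
by elim/weyl_ind=> s; rewrite !weyl_of_exprE; apply/weyl_of_exprP/wc_mul1r.
Qed.

Lemma weyl_mulDl : left_distributive weyl_mul weyl_add.
Proof.
elim/weyl_ind=> s; elim/weyl_ind=> t; elim/weyl_ind=> u.
by rewrite !weyl_of_exprE; apply/weyl_of_exprP/wc_mulDl.
Qed.

Lemma weyl_mulDr : right_distributive weyl_mul weyl_add.
Proof.
elim/weyl_ind=> s; elim/weyl_ind=> t; elim/weyl_ind=> u.
by rewrite !weyl_of_exprE; apply/weyl_of_exprP/wc_mulDr.
Qed.

Lemma weyl_one_neq0 : weyl_one != weyl_zero.
Proof.
apply/eqP => /weyl_of_exprP/(expr_act_cong (fun=> 1)) /=.
rewrite scale1r scale0r => /(congr1 (fun f : flog K n => f 0)) /eqP.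
by rewrite /= oner_eq0.
Qed.

HB.instance Definition _ := GRing.isNzRing.Build weyl
  weyl_addA weyl_addC weyl_add0 weyl_addN
  weyl_mulA weyl_mul1l weyl_mul1r weyl_mulDl weyl_mulDr weyl_one_neq0.

Lemma weyl_scaleA a b (P : weyl) :
  weyl_scale a (weyl_scale b P) = weyl_scale (a * b) P.
Proof.
elim/weyl_ind: P => s; rewrite !weyl_of_exprE; apply/weyl_of_exprP.
apply: (wc_trans (wc_mulA _ _ _)); apply: wc_mul (wc_refl _).
exact: wc_constM.
Qed.

Lemma weyl_scale1 : left_id 1 weyl_scale.
Proof.
by elim/weyl_ind=> s; rewrite !weyl_of_exprE; apply/weyl_of_exprP/wc_mul1l.
Qed.

Lemma weyl_scaleDr : right_distributive weyl_scale +%R.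
Proof.
move=> a; elim/weyl_ind=> s; elim/weyl_ind=> t.
by rewrite /GRing.add /= !weyl_of_exprE; apply/weyl_of_exprP/wc_mulDr.
Qed.

Lemma weyl_scaleDl (P : weyl) : {morph weyl_scale^~ P : a b / a + b}.
Proof.
move=> a b; elim/weyl_ind: P => s.
rewrite [RHS]/GRing.add /= !weyl_of_exprE; apply/weyl_of_exprP.
apply: wc_trans (wc_mulDl _ _ _); apply: wc_mul (wc_refl _).
exact/wc_sym/wc_constD.
Qed.

HB.instance Definition _ := GRing.Zmodule_isLmodule.Build K weyl
  weyl_scaleA weyl_scale1 weyl_scaleDr weyl_scaleDl.

Lemma weyl_scaleAl a (P Q : weyl) : a *: (P * Q) = a *: P * Q.
Proof.
elim/weyl_ind: P => s; elim/weyl_ind: Q => t.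
rewrite /GRing.mul /GRing.scale /= !weyl_of_exprE.
exact/weyl_of_exprP/wc_mulA.
Qed.

HB.instance Definition _ := GRing.Lmodule_isLalgebra.Build K weyl weyl_scaleAl.

Lemma weyl_scaleAr a (P Q : weyl) : a *: (P * Q) = P * (a *: Q).
Proof.
elim/weyl_ind: P => s; elim/weyl_ind: Q => t.
rewrite /GRing.mul /GRing.scale /= !weyl_of_exprE; apply/weyl_of_exprP.
apply: (wc_trans (wc_mulA _ _ _)); apply: wc_trans (wc_sym (wc_mulA _ _ _)).
exact: wc_mul (wc_constC _ _) (wc_refl _).
Qed.

HB.instance Definition _ := GRing.Lalgebra_isAlgebra.Build K weyl weyl_scaleAr.

Definition weylX (j : 'I_n) : weyl := weyl_of_expr (WX j).
Definition weylD (j : 'I_n) : weyl := weyl_of_expr (WD j).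

Definition weyl_act (P : weyl) : flog K n -> flog K n := expr_act (repr P).

Lemma weyl_actE s phi : weyl_act (weyl_of_expr s) phi = expr_act s phi.
Proof. exact/expr_act_cong/weyl_repr_pi. Qed.

Lemma weyl_actX j phi : weyl_act (weylX j) phi = flogX j phi.
Proof. exact: weyl_actE. Qed.

Lemma weyl_actD j phi : weyl_act (weylD j) phi = flogD j phi.
Proof. exact: weyl_actE. Qed.

Lemma weyl_act1 phi : weyl_act 1 phi = phi.
Proof. by rewrite weyl_actE /= scale1r. Qed.

Lemma weyl_actM (P Q : weyl) phi :
  weyl_act (P * Q) phi = weyl_act P (weyl_act Q phi).
Proof. exact: weyl_actE. Qed.

Lemma weyl_act_add (P Q : weyl) phi :
  weyl_act (P + Q) phi = weyl_act P phi + weyl_act Q phi.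
Proof. exact: weyl_actE. Qed.

Lemma weyl_actZ a (P : weyl) phi : weyl_act (a *: P) phi = a *: weyl_act P phi.
Proof. exact: weyl_actE. Qed.

Lemma weyl_act_linear (P : weyl) a phi psi :
  weyl_act P (a *: phi + psi) = a *: weyl_act P phi + weyl_act P psi.
Proof. exact: expr_act_linear. Qed.

Lemma weylD_weylX i j :
  weylD i * weylX j = weylX j * weylD i + (i == j)%:R.
Proof.
have -> : (i == j)%:R = weyl_of_expr (WConst (i == j)%:R) by case: (i == j).
rewrite [LHS]weyl_of_exprM.
have /weyl_of_exprP -> := wc_DX K i j.
by rewrite -weyl_of_exprD -weyl_of_exprM.
Qed.

(** The embedding of the commutative ring K[d_1, .., d_n]. *)
Definition weyl_of_diffpoly (p : {mpoly K[n]}) : weyl :=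
  mmap (fun a : K => a%:A) weylD p.

End WeylAlgebra.

Definition left_ideal (S : nzRingType) (G : set S) : set S :=
  [set P | exists s : seq (S * S),
     (forall q, q \in s -> G q.2) /\ P = \sum_(q <- s) q.1 * q.2].

Section Hypergeometric.
Variables (R : realType) (d n : nat) (A : 'M[int]_(d, n)).
Local Notation C := (R[i]).
Implicit Types (u : 'cV[int]_n) (g v : 'cV[C]_n) (Lam : set 'cV[C]_n).
Implicit Types (w : 'cV[R]_n) (I J M : {set 'I_n}).
Implicit Types (beta : 'cV[C]_d) (phi : flog C n).

Definition intvec u : 'cV[C]_n := map_mx intr u.

Definition latL : set 'cV[int]_n := [set u | A *m u = 0].

Definition exponent_lattice beta : set (set 'cV[C]_n) :=
  [set Lam | exists lam : 'cV[C]_n,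
     map_mx intr A *m lam = beta /\ Lam = [set lam + intvec u | u in latL]].

Definition pos_part u : 'X_{1..n} :=
  [multinom if (0 <= u j 0)%R then absz (u j 0)%R else 0 | j < n].
Definition neg_part u : 'X_{1..n} := pos_part (- u).

Definition toric_ideal : set {mpoly C[n]} :=
  left_ideal [set ('X_[pos_part u] - 'X_[neg_part u] : {mpoly C[n]})
             | u in latL].

Definition euler_op beta (i : 'I_d) : weyl C n :=
  \sum_(j < n) (A i j)%:~R *: (weylX C j * weylD C j) - (beta i 0)%:A.

Definition hyp_ideal beta : set (weyl C n) :=
  [set P | exists (P0 : weyl C n) (Q : 'I_d -> weyl C n),
     left_ideal [set weyl_of_diffpoly p | p in toric_ideal] P0 /\
     P = P0 + \sum_(i < d) Q i * euler_op beta i].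

Definition lattice_hull Lam : set 'cV[C]_n :=
  [set g | exists lam (u : 'cV[int]_n), Lam lam /\ g = lam + intvec u].

Definition supp phi : set 'cV[C]_n := [set g | phi g != 0].

Definition flog_space Lam : set (flog C n) :=
  [set phi | supp phi `<=` lattice_hull Lam].

Definition nsupp g : {set 'I_n} :=
  [set j | `[< exists m : int, (m < 0) /\ g j 0 = m%:~R >]]%SET.

Definition stratum Lam I : set 'cV[C]_n := [set g | Lam g /\ nsupp g = I].

Definition NS Lam : set {set 'I_n} := [set I | stratum Lam I !=set0].

Definition generic_dir w : Prop :=
  forall u, latL u -> u != 0 -> \sum_(j < n) w j 0 * (u j 0)%:~R != 0.

(** Extension of [w] to complex vectors. The order of R[i] is used for the
    comparisons below: [x <= y] means that [y - x] is a nonnegative real, and on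
    differences of points of an exponent lattice [wdot w] is real. *)
Definition wdot w g : C := \sum_(j < n) (w j 0)%:C * g j 0.

Definition wle w g v : Prop := 0 <= wdot w (v - g).
Definition wlt w g v : Prop := wle w g v /\ g <> v.

Definition is_wmin w (X : set 'cV[C]_n) v : Prop :=
  X v /\ forall g, X g -> wle w v g.

(** The minimum of [X], and the junk value 0 if [X] has no minimum. *)
Definition wmin w (X : set 'cV[C]_n) : 'cV[C]_n := xget 0 (is_wmin w X).

Definition Bset w Lam : set {set 'I_n} :=
  [set I | NS Lam I /\
     exists lam, Lam lam /\
       exists m : R, forall g, stratum Lam I g -> m%:C <= wdot w (g - lam)].

Definition vmin w Lam I : 'cV[C]_n := wmin w (stratum Lam I).

Definition Aset w Lam : set {set 'I_n} :=
  [set I | NS Lam I /\ forall J, NS Lam J -> J \subset I -> Bset w Lam J].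

Definition Aset_lt w Lam M : set {set 'I_n} :=
  [set J | Aset w Lam J /\ wlt w (vmin w Lam J) (vmin w Lam M)].

Definition sol_dir w beta Lam : set (flog C n) :=
  [set phi | [/\ flog_space Lam phi,
                 supp phi `<=` Lam,
                 forall P, hyp_ideal beta P -> weyl_act P phi = 0 &
                 phi = 0 \/ exists v, is_wmin w (supp phi) v]].

Definition lexp w phi : 'cV[C]_n := wmin w (supp phi).

Definition Rexp w beta Lam : set 'cV[C]_n :=
  [set lexp w phi | phi in [set phi | sol_dir w beta Lam phi /\ phi <> 0]].

(** Families of polynomials indexed by [NS Lam] are represented by functions on
    all subsets that vanish outside [NS Lam]. *)
Definition coeff_family := {set 'I_n} -> {mpoly C[n]}.

(** Differentiation by (A d_y)_i and by d_y^J. *)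
Definition dyA (i : 'I_d) (p : {mpoly C[n]}) : {mpoly C[n]} :=
  \sum_(j < n) (A i j)%:~R *: p^`M(j).
Definition dyset J (p : {mpoly C[n]}) : {mpoly C[n]} := p^`M[mesym1 J].

Definition coeff_dir w Lam : set coeff_family :=
  [set c | [/\ forall I, ~ NS Lam I -> c I = 0,
               forall I i, NS Lam I -> dyA i (c I) = 0,
               forall I J, NS Lam I -> NS Lam J ->
                 dyset (J :\: I)%SET (c I) = dyset (I :\: J)%SET (c J) &
               forall I, NS Lam I -> ~ Aset w Lam I -> c I = 0]].

Definition proj_at M : coeff_family -> {mpoly C[n]} := fun c => c M.

(** The components indexed by [Aset_lt w Lam M], the others being set to 0. *)
Definition proj_lt w Lam M : coeff_family -> coeff_family :=
  fun c => patch (fun=> 0) (Aset_lt w Lam M) c.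

Definition ker_proj_at w Lam M : set coeff_family :=
  [set c | coeff_dir w Lam c /\ proj_at M c = 0].
Definition ker_proj_lt w Lam M : set coeff_family :=
  [set c | coeff_dir w Lam c /\ proj_lt w Lam M c = 0].

End Hypergeometric.

(* Main.v *)
Require Import Defs.
From mathcomp Require Import all_boot all_order all_algebra.
From mathcomp Require Import mpoly complex.
From mathcomp Require Import boolp classical_sets functions reals.

(** Why the theorem holds. Write L for the kernel lattice of A, Lambda = lam + L
    and N(u) = nsupp (lam + u).

    The derivation d_j sends x^g p to x^(g - e_j) (g_j + d_{y_j}) p. On
    polynomials the operator g_j + d_{y_j} is invertible as soon as g_j is
    nonzero, because d_{y_j} is locally nilpotent. The invertible factors are
    absorbed by a change of unknown: there are automorphisms E(u) of C[y],
    commuting with all derivations (operator versions of the inverse Gamma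
    factors of a hypergeometric series), such that for phi(lam + u) = E(u) psi(u)
    the operator d_j acts on psi as a bare translation, followed by d_{y_j}
    exactly where the coordinate j passes from 0 to -1 ([gamma_family]). A
    monomial d^m then acts by translation followed by d_y^(N(u) \ N(u + m))
    ([act_monomial]).

    In these terms the toric equations on a series supported in Lambda say that
    d_y^(N(b) \ N(a)) psi(a) = d_y^(N(a) \ N(b)) psi(b) for all a, b in L: the
    two monomials of a binomial meet at the componentwise minimum of a and b,
    whose negative support is the union of N(a) and N(b) ([nsupp_meet],
    [box_act]). Taking N(a) = N(b), psi depends on the negative support alone, so
    psi(u) = c(N(u)); what remains of the toric equations is the compatibility of
    the c_I, and the Euler equations become (A d_y)_i c_I = 0
    ([coeffs_of_solution], [solution_of_coeffs]). The support of the series is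
    the union of the strata Lambda_I with c_I nonzero.

    It remains to translate the existence of a minimum of the support. Such a
    minimum bounds each Lambda_I with c_I nonzero from below. Moreover c_I =
    d_y^(I \ J) c_J for J contained in I, so that c_I nonzero forces c_J nonzero:
    all J below I are bounded too, which is the definition of A_w
    ([coeff_dirE]). Conversely a stratum on which w is bounded below has a
    minimum, by Dickson's lemma ([weight_min]), and the support is a finite union
    of strata. Hence the starting exponent of a solution is the least v_I with
    c_I nonzero, which is the assertion ([RexpP]). *)

Set Implicit Arguments.
Unset Strict Implicit.
Unset Printing Implicit Defensive.

Import Order.TTheory GRing.Theory Num.Theory.

Local Open Scope classical_set_scope.
Local Open Scope ring_scope.
Local Open Scope complex_scope.

(** * Constant-coefficient automorphisms of a polynomial ring *)

Section ConstantCoefficientOperators.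
Variables (K : fieldType) (n : nat).
Implicit Types (p q : {mpoly K[n]}) (a : K) (j : 'I_n).

Definition deriv_aut (f : {mpoly K[n]} -> {mpoly K[n]}) : Prop :=
  [/\ linear f, bijective f & forall j p, f p^`M(j) = (f p)^`M(j)].

Lemma deriv_aut_id : deriv_aut id.
Proof. by split=> //; exists id. Qed.

Lemma deriv_aut_comp f g : deriv_aut f -> deriv_aut g -> deriv_aut (f \o g).
Proof.
move=> [fL fB fD] [gL gB gD]; split=> [a p q|| j p] /=.
- by rewrite gL fL.
- exact: bij_comp.
- by rewrite gD fD.
Qed.

Lemma deriv_aut_inv f g : deriv_aut f -> cancel f g -> cancel g f ->
  deriv_aut g.
Proof.
move=> [fL _ fD] fK gK; split=> [a p q|| j p]; last 1 first.
- by apply: (can_inj fK); rewrite fD !gK.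
- by apply: (can_inj fK); rewrite fL !gK.
- by exists f.
Qed.

Lemma deriv_aut0 f : deriv_aut f -> f 0 = 0.
Proof.
by case=> fL _ _; have := fL (-1) 0 0; rewrite scaler0 addr0 scaleN1r addNr.
Qed.

Lemma deriv_autZ f a p : deriv_aut f -> f (a *: p) = a *: f p.
Proof.
move=> f_aut; have f0 := deriv_aut0 f_aut; case: f_aut => fL _ _.
by have := fL a p 0; rewrite f0 !addr0.
Qed.

Lemma deriv_autD f p q : deriv_aut f -> f (p + q) = f p + f q.
Proof. by case=> fL _ _; have := fL 1 p q; rewrite !scale1r. Qed.

Lemma deriv_autB f p q : deriv_aut f -> f (p - q) = f p - f q.
Proof.
by move=> f_aut; rewrite deriv_autD // -scaleN1r deriv_autZ // scaleN1r.
Qed.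

Lemma deriv_aut_sum f (I : Type) (r : seq I) (F : I -> {mpoly K[n]}) :
  deriv_aut f -> f (\sum_(i <- r) F i) = \sum_(i <- r) f (F i).
Proof.
move=> f_aut; apply: (big_morph f) => [p q|]; last exact: deriv_aut0.
exact: deriv_autD.
Qed.

Lemma deriv_aut_inj f : deriv_aut f -> injective f.
Proof. by case=> _ /bij_inj. Qed.

Lemma deriv_aut_eq0 f p : deriv_aut f -> (f p == 0) = (p == 0).
Proof.
move=> f_aut; rewrite -{1}(deriv_aut0 f_aut) (inj_eq (deriv_aut_inj f_aut)).
by [].
Qed.

Lemma mderiv_nilpotent j p : exists k, iter k (mderiv j) p = 0.
Proof.
exists (msize p); rewrite -mderivn_iter mderivnE big_seq big1 // => m mp.
rewrite ffact_small ?mul0r ?scale0r //.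
apply: leq_ltn_trans (msize_mdeg_lt mp); rewrite mdegE (bigD1 j) //=.
exact: leq_addr.
Qed.

Definition shift_deriv a j p := a *: p + p^`M(j).

Lemma shift_deriv_linear a j : linear (shift_deriv a j).
Proof.
move=> b p q; rewrite /shift_deriv mderivD mderivZ !scalerDr !scalerA.
by rewrite addrACA (mulrC a).
Qed.

Lemma shift_deriv_mderiv a i j p :
  shift_deriv a i p^`M(j) = (shift_deriv a i p)^`M(j).
Proof. by rewrite /shift_deriv mderivD mderivZ (mderiv_comm i j). Qed.

(** Local nilpotence of the derivation gives both halves. An element of the
    kernel is an eigenvector of a nilpotent operator for the nonzero eigenvalue
    [- a]; a preimage of [q] is found from one of its derivative by induction on
    the order of nilpotence. *)
Lemma deriv_aut_shift_deriv a j : a != 0 -> deriv_aut (shift_deriv a j).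
Proof.
move=> a_neq0; have sL := shift_deriv_linear a j.
split=> //; last exact: shift_deriv_mderiv.
have ker0 p : shift_deriv a j p = 0 -> p = 0.
  move=> /(canRL (addKr _)); rewrite addr0 => dp.
  have iter_dp k : iter k (mderiv j) p = (- a) ^+ k *: p.
    elim: k => [|k /= ->]; first by rewrite scale1r.
    by rewrite mderivZ dp -scaleNr scalerA -exprSr.
  have [k /eqP] := mderiv_nilpotent j p.
  by rewrite iter_dp scaler_eq0 expf_eq0 oppr_eq0 (negPf a_neq0) andbF => /eqP.
have surj q : exists p, shift_deriv a j p = q.
  have [k] := mderiv_nilpotent j q; elim: k q => [|k IHk] q.
    by move=> /= ->; exists 0; rewrite /shift_deriv scaler0 mderiv0 addr0.
  rewrite iterSr => /IHk [p p_q]; exists (a^-1 *: (q - p)).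
  have -> : a^-1 *: (q - p) = - a^-1 *: p + a^-1 *: q.
    by rewrite scaleNr -scalerN -scalerDr addrC.
  rewrite sL p_q /shift_deriv mderivZ scalerA divff // scale1r.
  by rewrite scaleNr addrCA addNr addr0.
have [g gK] := choice surj; exists g => // p.
apply/eqP; rewrite -subr_eq0; apply/eqP/ker0.
by rewrite addrC -scaleN1r sL gK scaleN1r addNr.
Qed.

(** [shift_deriv a j] is the product of an invertible part, [reg_shift a j], and
    of the derivation that remains when [a] vanishes, [sing_deriv a j]. *)
Definition reg_shift a j p := if a == 0 then p else shift_deriv a j p.
Definition sing_deriv a j p := if a == 0 then p^`M(j) else p.

Lemma deriv_aut_reg_shift a j : deriv_aut (reg_shift a j).
Proof.
rewrite /reg_shift; case: (eqVneq a 0) => [_|a0]; first exact: deriv_aut_id.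
exact: deriv_aut_shift_deriv.
Qed.

Lemma shift_derivE a j p : shift_deriv a j p = sing_deriv a j (reg_shift a j p).
Proof.
rewrite /sing_deriv /reg_shift; case: eqVneq => [->|//].
by rewrite /shift_deriv scale0r add0r.
Qed.

Lemma sing_deriv_aut f a j p : deriv_aut f ->
  f (sing_deriv a j p) = sing_deriv a j (f p).
Proof. by case=> _ _ fD; rewrite /sing_deriv; case: ifP. Qed.

Lemma reg_shift_aut f a j p : deriv_aut f ->
  f (reg_shift a j p) = reg_shift a j (f p).
Proof.
move=> f_aut; rewrite /reg_shift /shift_deriv; case: ifP => // _.
by rewrite deriv_autD // deriv_autZ //; case: f_aut => _ _ ->.
Qed.

(** The functional equation is that of [1 / Gamma (a + z + 1 + d_{y_j})], with
    the vanishing factor left out. It is solved from [z = 0], upwards by the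
    inverses of the [reg_shift] and downwards by the [reg_shift] themselves. *)
Lemma gamma_coord a j : exists F : int -> {mpoly K[n]} -> {mpoly K[n]},
  forall z, deriv_aut (F z) /\
    forall p, F z p = reg_shift (a + z%:~R + 1) j (F (z + 1) p).
Proof.
have inv b : exists g, [/\ cancel (reg_shift b j) g & cancel g (reg_shift b j)].
  by case: (deriv_aut_reg_shift b j) => _ [g gK Kg] _; exists g.
have [G GP] := choice inv.
have G_aut b : deriv_aut (G b).
  by case: (GP b); apply: deriv_aut_inv; apply: deriv_aut_reg_shift.
pose Fp := fix Fp k := if k is k'.+1 then G (a + k'%:R + 1) \o Fp k' else id.
pose Fn := fix Fn k :=
  if k is k'.+1 then reg_shift (a - k'%:R) j \o Fn k' else id.
have Fp_aut k : deriv_aut (Fp k).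
  by elim: k => [|k IHk]; [exact: deriv_aut_id | exact: deriv_aut_comp].
have Fn_aut k : deriv_aut (Fn k).
  elim: k => [|k IHk]; first exact: deriv_aut_id.
  by apply: deriv_aut_comp => //; apply: deriv_aut_reg_shift.
exists (fun z => match z with Posz k => Fp k | Negz k => Fn k.+1 end).
case=> k; split.
- exact: Fp_aut.
- move=> p; rewrite -PoszD addn1 /= -pmulrn.
  by case: (GP (a + k%:R + 1)) => _ ->.
- exact: (Fn_aut k.+1).
- move=> p; rewrite NegzE.
  have -> : a + (- (k.+1)%:Z)%:~R + 1 = a - k%:R.
    by rewrite rmorphN /= -pmulrn -natr1 opprD addrA subrK.
  have -> : - (k.+1)%:Z + 1 = - k%:Z by rewrite -addn1 PoszD opprD subrK.
  by case: k.
Qed.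

(** [E u] plays the part of the product over [j] of the operators
    [1 / Gamma (g_j + u_j + 1 + d_{y_j})]: only the functional equation matters. *)
Definition gamma_factors (g : 'cV[K]_n)
    (E : 'cV[int]_n -> {mpoly K[n]} -> {mpoly K[n]}) : Prop :=
  forall u, deriv_aut (E u) /\ forall j p,
    E u p = reg_shift (g j 0 + (u j 0)%:~R + 1) j (E (u + delta_mx j 0) p).

(** The composite over [j] of the operators of [gamma_coord]: a unit step in the
    direction [j] changes only the factor [j], and the [reg_shift] it produces
    commutes with the other factors. *)
Lemma gamma_family (g : 'cV[K]_n) :
  exists E, gamma_factors g E.
Proof.
have [F FP] := choice (fun j => gamma_coord (g j 0) j).
pose E s (u : 'cV[int]_n) := foldr (fun j f => F j (u j 0) \o f) id s.
have E_aut s u : deriv_aut (E s u).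
  elim: s => [|j s IHs] /=; first exact: deriv_aut_id.
  by apply: deriv_aut_comp => //; case: (FP j (u j 0)).
have shiftE (u : 'cV[int]_n) i j :
    (u + delta_mx j 0) i 0 = u i 0 + (i == j)%:R.
  by rewrite !mxE eqxx andbT.
have E_notin s u j p : j \notin s -> E s (u + delta_mx j 0) p = E s u p.
  elim: s => [//|i s IHs]; rewrite inE negb_or => /andP[ji js] /=.
  by rewrite IHs // shiftE eq_sym (negPf ji) addr0.
have E_in s u j p : uniq s -> j \in s ->
    E s u p = reg_shift (g j 0 + (u j 0)%:~R + 1) j (E s (u + delta_mx j 0) p).
  elim: s => [//|i s IHs] /= /andP[i_s s_uniq]; rewrite inE shiftE.
  case: (eqVneq i j) => [<- _|ij /= js]; last first.
    by rewrite addr0 IHs // reg_shift_aut //; case: (FP i (u i 0)).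
  by rewrite E_notin //; case: (FP i (u i 0)) => _ ->.
exists (E (enum 'I_n)) => u; split=> [|j p]; first exact: E_aut.
by apply: E_in; rewrite ?enum_uniq ?mem_enum.
Qed.

End ConstantCoefficientOperators.

(** * Differential monomials acting on logarithmic series *)

Section DifferentialMonomials.
Variables (K : comNzRingType) (n : nat).
Implicit Types (p q : {mpoly K[n]}) (phi : flog K n).

(** Pairwise commutation of the [h i] suffices, which covers the derivations of
    the Weyl algebra: they commute with each other but are not central. *)
Lemma mmap1D_comm (S : nzRingType) (h : 'I_n -> S) m1 m2 :
  (forall i j, GRing.comm (h i) (h j)) ->
  mmap1 h (m1 + m2) = mmap1 h m1 * mmap1 h m2.
Proof.
move=> h_comm; rewrite /mmap1; elim: (index_enum _) => [|i s IHs].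
  by rewrite !big_nil mulr1.
rewrite !big_cons {}IHs mnmDE exprD -!mulrA; congr (_ * _).
rewrite !mulrA; congr (_ * _); apply/commr_sym.
apply: (big_ind (fun y => GRing.comm y (h i ^+ m2 i))) => [||j _].
- exact/commr_sym/commr1.
- by move=> x y xh yh; apply/commr_sym/commrM; apply/commr_sym.
- exact/commrX/commr_sym/commrX/h_comm.
Qed.

Lemma weylD_comm i j : GRing.comm (weylD K i : weyl K n) (weylD K j).
Proof.
rewrite /GRing.comm /GRing.mul /= !weyl_of_exprM.
exact/weyl_of_exprP/wc_DD.
Qed.

Lemma weyl_of_diffpolyZ a p :
  weyl_of_diffpoly (a *: p) = a *: weyl_of_diffpoly p.
Proof. by rewrite /weyl_of_diffpoly (mmapZ _ (in_alg _)) mulr_algl. Qed.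

Lemma weyl_of_diffpolyB p q :
  weyl_of_diffpoly (p - q) = weyl_of_diffpoly p - weyl_of_diffpoly q.
Proof. exact: (mmapB _ (in_alg _)). Qed.

Lemma weyl_of_diffpoly_sum (I : Type) (r : seq I) (F : I -> {mpoly K[n]}) :
  weyl_of_diffpoly (\sum_(i <- r) F i) = \sum_(i <- r) weyl_of_diffpoly (F i).
Proof. exact: (raddf_sum (mmap (in_alg _) _)). Qed.

Lemma weyl_of_diffpolyX m :
  weyl_of_diffpoly ('X_[m] : {mpoly K[n]}) = mmap1 (@weylD K n) m.
Proof. exact: (mmapX _ (in_alg _)). Qed.

Lemma weyl_of_diffpolyM p q :
  weyl_of_diffpoly (p * q) = weyl_of_diffpoly p * weyl_of_diffpoly q.
Proof.
rewrite [p]mpolyE [q]mpolyE big_distrlr /= !weyl_of_diffpoly_sum big_distrlr /=.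
apply: eq_bigr => m _; rewrite weyl_of_diffpoly_sum; apply: eq_bigr => m' _.
rewrite -scalerAl -scalerAr -mpolyXD !weyl_of_diffpolyZ !weyl_of_diffpolyX.
by rewrite mmap1D_comm -?scalerAl -?scalerAr //; apply: weylD_comm.
Qed.

Lemma weyl_act_sum (I : Type) (r : seq I) (P : I -> weyl K n) phi :
  weyl_act (\sum_(i <- r) P i) phi = \sum_(i <- r) weyl_act (P i) phi.
Proof.
apply: (big_morph (fun T => weyl_act T phi)) => [T U|].
  exact: weyl_act_add.
by rewrite -[0 in LHS](scale0r (1 : weyl K n)) weyl_actZ scale0r.
Qed.

Lemma weyl_act0 P : weyl_act P 0 = 0 :> flog K n.
Proof. exact: expr_act0. Qed.

Lemma left_ideal_act (G : set (weyl K n)) phi :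
  (forall P, G P -> weyl_act P phi = 0) ->
  forall P, left_ideal G P -> weyl_act P phi = 0.
Proof.
move=> G0 _ [s [sG ->]]; rewrite weyl_act_sum big_seq big1 // => q /sG/G0 q0.
by rewrite weyl_actM q0 weyl_act0.
Qed.

Lemma left_ideal_gen (S : nzRingType) (G : set S) P : G P -> left_ideal G P.
Proof.
exists [:: (1, P)]; split=> [q|]; first by rewrite inE => /eqP ->.
by rewrite big_seq1 mul1r.
Qed.

Lemma mderivm_mesym1_set0 p : p^`M[mesym1 finset.set0] = p.
Proof. by rewrite mesym1_set0 mderivm0m. Qed.

Lemma mesym1_setU1 j (I : {set 'I_n}) : j \notin I ->
  mesym1 (j |: I) = (mesym1 I + U_(j))%MM.
Proof.
move=> jI; apply/mnmP => k; rewrite mnmDE mnm1E !mnmE in_setU1 (eq_sym j).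
by case: eqVneq => [->|]; rewrite ?(negPf jI) ?addn0.
Qed.

End DifferentialMonomials.

Section NegativeSupport.
Variables (R : realType) (n : nat).
Local Notation C := (R[i]).
Implicit Types (g : 'cV[C]_n) (u v : 'cV[int]_n).

Lemma intvec_delta j : intvec R (delta_mx j 0 : 'cV[int]_n) = basis_vec C j.
Proof. by apply/matrixP => i k; rewrite !mxE; case: (_ && _). Qed.

Lemma intvecD u v : intvec R (u + v) = intvec R u + intvec R v.
Proof. exact: map_mxD. Qed.

Lemma intvecN u : intvec R (- u) = - intvec R u.
Proof. exact: map_mxN. Qed.

Lemma intvecE u j : intvec R u j 0 = (u j 0)%:~R.
Proof. by rewrite mxE. Qed.

Lemma intvec_inj : injective (@intvec R n).
Proof.
move=> u v uv; apply/matrixP => i k; rewrite (ord1 k).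
have /matrixP/(_ i 0) := uv; rewrite !mxE => /intr_inj; exact.
Qed.

Lemma nsuppP g j :
  reflect (exists m : int, (m < 0) /\ g j 0 = m%:~R) (j \in nsupp g).
Proof. by rewrite inE; apply: asboolP. Qed.

Lemma nsupp_exit g j : g j 0 + 1 = 0 -> j \in nsupp g.
Proof.
by move/eqP; rewrite addr_eq0 => /eqP gj; apply/nsuppP; exists (-1); rewrite gj.
Qed.

(** A unit step leaves the negative support unchanged unless the coordinate [j]
    passes from -1 to 0. *)
Lemma nsuppD1 g j : nsupp (g + basis_vec C j) =
  if g j 0 + 1 == 0 then (nsupp g :\ j)%SET else nsupp g.
Proof.
have gD k : (g + basis_vec C j) k 0 = g k 0 + (j == k)%:R.
  by rewrite !mxE eqxx andbT eq_sym.
apply/finset.setP => k; case: (eqVneq j k) => [<-|jk].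
- apply/nsuppP/idP => [[m [m0]]|].
  + rewrite gD eqxx => gm; case: eqP => [g0|_].
      move: m0; rewrite g0 in gm; move/eqP: gm.
      by rewrite eq_sym intr_eq0 => /eqP ->.
    apply/nsuppP; exists (m - 1); split.
      by rewrite subr_lt0 (lt_trans m0).
    by rewrite rmorphB /= -gm addrK.
  + case: eqP; first by rewrite in_setD1 eqxx.
    move=> g0 /nsuppP[m [m0 gm]]; exists (m + 1); split; last first.
      by rewrite gD eqxx gm rmorphD.
    rewrite lt_neqAle lezD1 m0 andbT; apply/eqP => m1; apply: g0.
    by rewrite gm -[1]/(1%:~R) -rmorphD /= m1.
- have -> : (k \in nsupp (g + basis_vec C j)) = (k \in nsupp g).
    apply/nsuppP/nsuppP => -[m [m0 gm]]; exists m; split=> //; move: gm;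
      by rewrite gD (negPf jk) addr0.
  by case: ifP => // _; rewrite in_setD1 eq_sym jk.
Qed.

Definition mnm_vec (m : 'X_{1..n}) : 'cV[int]_n := \col_j (m j)%:Z.

(** The derivation left over by one step of [d_j] is the one that accounts for
    [j] leaving the negative support, so these derivations accumulate to a
    [dyset] along a monomial. *)
Lemma dyset_step g (j : 'I_n) (I : {set 'I_n}) p :
  nsupp g \subset I ->
  dyset (I :\: nsupp g)%SET (sing_deriv (g j 0 + 1) j p) =
  dyset (I :\: nsupp (g + basis_vec C j))%SET p.
Proof.
move=> gI; rewrite nsuppD1 /sing_deriv; case: ifP => [/eqP/nsupp_exit gj|//].
have -> : (I :\: (nsupp g :\ j) = j |: (I :\: nsupp g))%SET.
  apply/finset.setP => k; rewrite in_setU1 !finset.in_setD.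
  rewrite finset.in_set1 negb_and negbK.
  by case: (eqVneq k j) => [->|//]; rewrite (fintype.subsetP gI _ gj).
rewrite /dyset mesym1_setU1; last by rewrite finset.in_setD gj.
by rewrite addmC mderivmDm mderivmU1m.
Qed.

Lemma nsuppD_sub g m : nsupp (g + intvec R (mnm_vec m)) \subset nsupp g.
Proof.
apply/fintype.subsetP => k /nsuppP[z [z0 gz]]; apply/nsuppP.
exists (z - (m k)%:Z).
split; first by rewrite (le_lt_trans _ z0) // gerBl.
by rewrite rmorphB /= -gz !mxE addrK.
Qed.

(** After the change of unknown by [E], a differential monomial becomes a
    translation of [psi], followed by the derivations in the coordinates that
    turn negative. *)
Lemma act_monomial g (E : 'cV[int]_n -> {mpoly C[n]} -> {mpoly C[n]})
    (psi : 'cV[int]_n -> {mpoly C[n]}) (phi : flog C n) m :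
  gamma_factors g E ->
  (forall u, phi (g + intvec R u) = E u (psi u)) ->
  forall u, weyl_act (weyl_of_diffpoly 'X_[m]) phi (g + intvec R u) =
    E u (dyset (nsupp (g + intvec R u) :\:
                nsupp (g + intvec R (u + mnm_vec m)))%SET
           (psi (u + mnm_vec m))).
Proof.
move=> EP; rewrite weyl_of_diffpolyX.
(* induction on the degree, splitting off one variable [j] at a time *)
have [k mk] := ubnP (mdeg m); elim: k => // k IHk in m mk psi phi *.
move=> phiE u; have [m0|] := eqVneq m 0%MM.
  have -> : mnm_vec m = 0 by apply/matrixP => i j; rewrite !mxE m0 mnm0E.
  rewrite m0 mmap11 weyl_act1 addr0 finset.setDv.
  by rewrite /dyset mderivm_mesym1_set0 phiE.
move=> m_neq0; have [j mj] : exists j, (0 < m j)%N.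
  apply/existsP; apply: contraNT m_neq0; rewrite negb_exists => /forallP m0.
  apply/eqP/mnmP => i; rewrite mnm0E; apply/eqP.
  by have := m0 i; rewrite -leqNgt leqn0.
have Em : m = ((m - U_(j)) + U_(j))%MM.
  by rewrite submK //; apply/mnm_lepP => i; rewrite mnm1E; case: eqP => // <-.
move: (m - U_(j))%MM Em => m' Em {mj m_neq0}; rewrite Em.
rewrite mmap1D_comm; last exact: weylD_comm.
rewrite mmap1U weyl_actM weyl_actD.
have mk' : (mdeg m' < k)%N.
  by move: mk; rewrite Em mdegD mdeg1 addn1 ltnS.
rewrite (IHk m' mk' (fun u => sing_deriv (g j 0 + (u j 0)%:~R + 1) j
                       (psi (u + delta_mx j 0)))); last first.
  move=> v; rewrite /flogD -addrA -intvec_delta -intvecD phiE.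
  have [Ev_aut EvE] := EP v.
  rewrite (sing_deriv_aut _ _ _ Ev_aut) (EvE j) -shift_derivE /shift_deriv.
  congr (_ *: _ + _); rewrite !mxE eqxx /= rmorphD /= addrA.
  by congr (_ + _); rewrite eqxx.
have -> : mnm_vec (m' + U_(j)) = mnm_vec m' + delta_mx j 0.
  apply/matrixP => i k'; rewrite !mxE mnmDE mnm1E (ord1 k') eqxx andbT PoszD.
  by rewrite eq_sym; case: (_ == _).
congr (E u _); rewrite !addrA [in RHS]intvecD intvec_delta addrA.
rewrite -dyset_step; last by rewrite intvecD addrA nsuppD_sub.
by rewrite !mxE.
Qed.

End NegativeSupport.

(** * The toric and Euler equations *)

Section AnnihilatedSeries.
Variables (R : realType) (d n : nat) (A : 'M[int]_(d, n)).
Variable beta : 'cV[R[i]]_d.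
Local Notation C := (R[i]).
Implicit Types (phi : flog C n) (u v a b : 'cV[int]_n) (g : 'cV[C]_n).

Definition box_op u : weyl C n :=
  weyl_of_diffpoly ('X_[pos_part u] - 'X_[neg_part u]).

Lemma hyp_ideal_annihilates phi :
  (forall P, hyp_ideal A beta P -> weyl_act P phi = 0) <->
  (forall u, latL A u -> weyl_act (box_op u) phi = 0) /\
  (forall i, weyl_act (euler_op A beta i) phi = 0).
Proof.
split=> [ann|[box0 euler0] _ [P0 [Q [P0I ->]]]].
- split=> [u uL|i]; apply: ann.
  + exists (box_op u), (fun=> 0); split; last first.
      by rewrite big1 ?addr0 // => i _; rewrite mul0r.
    apply: left_ideal_gen; exists ('X_[pos_part u] - 'X_[neg_part u]) => //.
    by apply: left_ideal_gen; exists u.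
  + exists 0, (fun j => (j == i)%:R); split.
      by exists [::]; rewrite big_nil.
    rewrite add0r (bigD1 i) //= eqxx mul1r big1 ?addr0 // => j /negPf ->.
    by rewrite mul0r.
- rewrite weyl_act_add weyl_act_sum big1 => [|i _]; last first.
    by rewrite weyl_actM euler0 weyl_act0.
  rewrite addr0; apply: left_ideal_act P0I => _ [p [s [sG ->]] <-].
  rewrite weyl_of_diffpoly_sum weyl_act_sum big_seq big1 // => q /sG[u uL <-].
  by rewrite weyl_of_diffpolyM weyl_actM box0 // weyl_act0.
Qed.

Lemma euler_act phi i g :
  weyl_act (euler_op A beta i) phi g =
  ((map_mx intr A *m g) i 0 - beta i 0) *: phi g + dyA A i (phi g).
Proof.
rewrite /euler_op -scaleNr weyl_act_add weyl_actZ weyl_act1 weyl_act_sum.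
rewrite fctE fct_sumE /=.
under eq_bigr do rewrite weyl_actZ weyl_actM weyl_actX weyl_actD.
rewrite scalerBl addrAC -scaleNr; congr (_ + _).
rewrite mxE scaler_suml /dyA -big_split /=; apply: eq_bigr => j _.
rewrite /flogX /flogD [LHS]/GRing.scale /= subrK scalerDr scalerA.
by rewrite mxE.
Qed.

Lemma nsupp_le g u v j : u j 0 <= v j 0 ->
  j \in nsupp (g + intvec R v) -> j \in nsupp (g + intvec R u).
Proof.
move=> uv /nsuppP[m [m0 gv]]; apply/nsuppP; exists (m - (v j 0 - u j 0)).
split; first by rewrite (le_lt_trans _ m0) // gerBl subr_ge0.
by rewrite !rmorphB /= -gv !mxE opprB addrACA subrr addr0.
Qed.

Lemma mnm_vec_pos_part u j : mnm_vec (pos_part u) j 0 = Num.max (u j 0) 0.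
Proof.
rewrite !mxE mnmE; case: leP => [u0|/ltW u0]; first by rewrite gez0_abs.
by [].
Qed.

Lemma mnm_vec_pos_neg u : mnm_vec (pos_part u) = u + mnm_vec (neg_part u).
Proof.
apply/matrixP => j k; rewrite (ord1 k) /neg_part [RHS]mxE !mnm_vec_pos_part mxE.
case: (leP (u j 0) 0) => u0.
  by rewrite max_l ?oppr_ge0 // subrr.
by rewrite max_r ?addr0 // oppr_le0 ltW.
Qed.

(** Both endpoints are obtained from [v] by adding nonnegative vectors of
    disjoint supports, so that [v] is their componentwise minimum. *)
Lemma nsupp_meet g u v :
  nsupp (g + intvec R v) =
    (nsupp (g + intvec R (v + mnm_vec (pos_part u))) :|:
     nsupp (g + intvec R (v + mnm_vec (neg_part u))))%SET.
Proof.
have posE : (v + mnm_vec (pos_part u)) ^~ 0 =1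
    (fun j => v j 0 + Num.max (u j 0) 0).
  by move=> j; rewrite -mnm_vec_pos_part mxE.
have negE : (v + mnm_vec (neg_part u)) ^~ 0 =1
    (fun j => v j 0 + Num.max (- u j 0) 0).
  by move=> j; rewrite mxE mnm_vec_pos_part mxE.
apply/finset.setP => j; rewrite finset.in_setU.
apply/idP/orP => [vN|[] wN].
- case: (leP (u j 0) 0) => u0; [left|right]; move: vN; apply: nsupp_le.
    by rewrite posE max_r // addr0.
  by rewrite negE max_r ?addr0 // oppr_le0 ltW.
- by apply: nsupp_le wN; rewrite posE lerDl le_max lexx orbT.
- by apply: nsupp_le wN; rewrite negE lerDl le_max lexx orbT.
Qed.

Section GammaFactors.
Variables (g : 'cV[C]_n) (E : 'cV[int]_n -> {mpoly C[n]} -> {mpoly C[n]}).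
Hypothesis EP : gamma_factors g E.
Local Notation N u := (nsupp (g + intvec R u)).

Let E_aut u : deriv_aut (E u). Proof. by have [] := EP u. Qed.

(** Since the negative support at [v] is the union of those at [a] and [b], the
    derivations of [act_monomial] depend on [a] and [b] only. *)
Lemma box_act phi psi u v :
  (forall v, phi (g + intvec R v) = E v (psi v)) ->
  let a := v + mnm_vec (pos_part u) in let b := v + mnm_vec (neg_part u) in
  weyl_act (box_op u) phi (g + intvec R v) =
    E v (dyset (N b :\: N a)%SET (psi a) - dyset (N a :\: N b)%SET (psi b)).
Proof.
move=> phiE a b.
rewrite /box_op weyl_of_diffpolyB weyl_act_add -scaleN1r weyl_actZ scaleN1r.
rewrite fctE; set X := weyl_act _ phi; set Y := weyl_act _ phi.
have -> : (- Y) (g + intvec R v) = - Y (g + intvec R v) by [].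
rewrite /X /Y !(act_monomial _ EP phiE) (nsupp_meet g u v).
rewrite !finset.setDUl !finset.setDv finset.set0U finset.setU0.
by rewrite (deriv_autB _ _ (E_aut v)).
Qed.

End GammaFactors.

End AnnihilatedSeries.

(** * Solutions supported on an exponent lattice *)

Section SolutionsAndCoefficients.
Variables (R : realType) (d n : nat) (A : 'M[int]_(d, n)).
Local Notation C := (R[i]).
Variables (beta : 'cV[C]_d) (lam : 'cV[C]_n).
Hypothesis lamE : map_mx intr A *m lam = beta.
Local Notation Lam := [set lam + intvec R u | u in latL A].
Local Notation N u := (nsupp (lam + intvec R u)).
Implicit Types (phi : flog C n) (c : coeff_family R n) (I J : {set 'I_n}).

Lemma latL0 : latL A 0. Proof. exact: mulmx0. Qed.

Lemma latLN u : latL A u -> latL A (- u).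
Proof. by rewrite /latL /= mulmxN => ->; rewrite oppr0. Qed.

Lemma latLD u v : latL A u -> latL A v -> latL A (u + v).
Proof. by rewrite /latL /= mulmxDr => -> ->; rewrite addr0. Qed.

Lemma latLB u v : latL A u -> latL A v -> latL A (u - v).
Proof. by move=> uL vL; apply/latLD/latLN. Qed.

Lemma lattice_weight g : Lam g -> map_mx intr A *m g = beta.
Proof.
case=> u uL <-; rewrite mulmxDr lamE.
have -> : map_mx intr A *m intvec R u = map_mx intr (A *m u).
  by rewrite map_mxM.
by rewrite [A *m u]uL map_mx0 addr0.
Qed.

Lemma NS_N u : latL A u -> NS Lam (N u).
Proof. by move=> uL; exists (lam + intvec R u); split=> //; exists u. Qed.

Lemma NSP I : NS Lam I -> exists2 u, latL A u & N u = I.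
Proof. by case=> _ [[u uL <-] <-]; exists u. Qed.

(** The conditions of [coeff_dir] that do not involve the direction. *)
Definition compatible c :=
  [/\ forall I, ~ NS Lam I -> c I = 0,
      forall I i, NS Lam I -> dyA A i (c I) = 0 &
      forall I J, NS Lam I -> NS Lam J ->
        dyset (J :\: I)%SET (c I) = dyset (I :\: J)%SET (c J)].

Variable E : 'cV[int]_n -> {mpoly C[n]} -> {mpoly C[n]}.
Hypothesis EP : gamma_factors lam E.
Let E_aut u : deriv_aut (E u). Proof. by have [] := EP u. Qed.

Lemma dyA_aut f i (p : {mpoly C[n]}) :
  deriv_aut f -> dyA A i (f p) = f (dyA A i p).
Proof.
move=> f_aut; rewrite /dyA deriv_aut_sum //; apply: eq_bigr => j _.
by rewrite deriv_autZ //; case: f_aut => _ _ ->.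
Qed.

(** The binomial of [a - b], evaluated at the minimum of [a] and [b], relates the
    coefficients at these two points. For equal negative supports the relation is
    an equality, hence the coefficients depend on the stratum alone. *)
Lemma coeffs_of_solution phi : supp phi `<=` Lam ->
  (forall P, hyp_ideal A beta P -> weyl_act P phi = 0) ->
  exists c, compatible c /\
    forall u, latL A u -> phi (lam + intvec R u) = E u (c (N u)).
Proof.
move=> phiL /hyp_ideal_annihilates[box0 euler0].
have /choice[psi psiE] : forall u, exists p, phi (lam + intvec R u) = E u p.
  move=> u; have [_ [f _ fK] _] := E_aut u.
  by exists (f (phi (lam + intvec R u))).
have psi_pair a b : latL A a -> latL A b ->
    dyset (N b :\: N a)%SET (psi a) = dyset (N a :\: N b)%SET (psi b).
  move=> aL bL; pose v := a - mnm_vec (pos_part (a - b)).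
  have aE : v + mnm_vec (pos_part (a - b)) = a by rewrite subrK.
  have bE : v + mnm_vec (neg_part (a - b)) = b.
    by rewrite /v mnm_vec_pos_neg opprD addrA subrK opprB addrCA subrr addr0.
  have := congr1 (fun f : flog C n => f (lam + intvec R v))
                 (box0 _ (latLB aL bL)).
  rewrite (box_act EP _ _ psiE) aE bE => /eqP.
  by rewrite (deriv_aut_eq0 _ (E_aut v)) subr_eq0 => /eqP.
have psi_N a b : latL A a -> latL A b -> N a = N b -> psi a = psi b.
  move=> aL bL Nab; have := psi_pair _ _ aL bL.
  by rewrite Nab finset.setDv /dyset !mderivm_mesym1_set0.
pose pt I := xget 0 [set u | latL A u /\ N u = I].
have ptP I : NS Lam I -> latL A (pt I) /\ N (pt I) = I.
  move=> /NSP[u uL uI]; rewrite /pt; case: xgetP => [v _ //|].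
  by move=> /(_ u) /=; case.
exists (fun I => if `[< NS Lam I >] then psi (pt I) else 0); split; last first.
  move=> u uL; rewrite asboolT; last exact: NS_N.
  have [ptL ptN] := ptP _ (NS_N uL).
  by rewrite psiE (psi_N _ _ uL ptL).
split=> [I nI|I i nI|I J nI nJ].
- by rewrite asboolF.
- rewrite asboolT //; have [ptL ptN] := ptP _ nI.
  have /eqP := congr1 (fun f : flog C n => f (lam + intvec R (pt I)))
                      (euler0 i).
  rewrite /= euler_act lattice_weight; last by exists (pt I).
  rewrite subrr scale0r add0r.
  by rewrite psiE dyA_aut // deriv_aut_eq0 // => /eqP.
- rewrite !asboolT //.
  have [aL aN] := ptP _ nI; have [bL bN] := ptP _ nJ.
  by have := psi_pair _ _ aL bL; rewrite aN bN.
Qed.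

(** The two ends [a] and [b] of a binomial differ by an element of the lattice,
    hence both lie in it, where [compatible] applies, or both outside, where the
    series vanishes. *)
Lemma solution_of_coeffs c : compatible c ->
  exists phi, [/\ supp phi `<=` Lam,
    forall P, hyp_ideal A beta P -> weyl_act P phi = 0 &
    forall u, latL A u -> phi (lam + intvec R u) = E u (c (N u))].
Proof.
move=> [_ c_dyA c_pair].
pose psi u := if `[< latL A u >] then c (N u) else 0.
pose pt g := xget 0 [set u | g = lam + intvec R u].
have ptK u : pt (lam + intvec R u) = u.
  rewrite /pt; case: xgetP => [v _ /addrI/intvec_inj //|].
  by move=> /(_ u) /=; case.
pose hull g := `[< exists u, g = lam + intvec R u >].
pose phi : flog C n := fun g => if hull g then E (pt g) (psi (pt g)) else 0.
have phiE u : phi (lam + intvec R u) = E u (psi u).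
  by rewrite /phi ptK ifT //; apply/asboolP; exists u.
have phi0 g : ~ Lam g -> phi g = 0.
  move=> gL; rewrite /phi; case: ifP => // /asboolP[u gE].
  rewrite gE ptK /psi asboolF ?deriv_aut0 //.
  by move=> uL; apply: gL; rewrite gE; exists u.
exists phi; split.
- move=> g gs; apply: contrapT => /phi0 g0; move: gs.
  by rewrite /supp /= g0 eqxx.
- apply/hyp_ideal_annihilates; split=> [u uL|i]; apply: funext => g; last first.
    rewrite euler_act; case: (pselect (Lam g)) => [gL|/phi0 ->]; last first.
      rewrite scaler0 add0r /dyA big1 // => j _.
      by rewrite mderiv0 scaler0.
    rewrite lattice_weight // subrr scale0r add0r.
    case: gL => v vL <-; rewrite phiE dyA_aut // /psi asboolT //.
    by rewrite c_dyA ?deriv_aut0 //; apply: NS_N.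
  case: (boolP (hull g)) => [/asboolP[v ->]|].
    rewrite (box_act EP _ _ phiE) /psi /=.
    set a := v + mnm_vec (pos_part u); set b := v + mnm_vec (neg_part u).
    have abE : a = b + u by rewrite /a mnm_vec_pos_neg addrCA addrC.
    have ab : `[< latL A a >] = `[< latL A b >].
      apply/asboolP/asboolP => [aL|bL]; last by rewrite abE; apply: latLD.
      by rewrite -(addrK u b) -abE; apply: latLB.
    rewrite ab; case: asboolP => [bL|_]; last first.
      by rewrite /dyset !linear0 addr0 deriv_aut0.
    have aL : latL A a by rewrite abE; apply: latLD.
    by rewrite (c_pair _ _ (NS_N aL) (NS_N bL)) subrr deriv_aut0.
  (* away from [lam + Z^n] the series vanishes near [g]: use the family based
     at [g] itself, with [psi = 0] *)
  move=> /asboolPn g_hull; have [F FP] := gamma_family g.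
  have phi_g v : phi (g + intvec R v) = F v 0.
    rewrite deriv_aut0; last by have [] := FP v.
    rewrite /phi; case: ifP => // /asboolP[v' gE]; case: g_hull.
    by exists (v' - v); rewrite intvecD intvecN addrA -gE addrK.
  have := box_act FP u 0 phi_g.
  rewrite /intvec map_mx0 addr0 => ->.
  by rewrite /dyset !linear0 addr0 deriv_aut0 //; have [] := FP 0.
- by move=> u uL; rewrite phiE /psi asboolT.
Qed.

End SolutionsAndCoefficients.

(** * Minima of strata in a generic direction *)

Lemma nondecreasing_subseq (a : nat -> nat) : exists s : nat -> nat,
  forall i j, (i < j)%N -> (s i < s j)%N && (a (s i) <= a (s j))%N.
Proof.
have /choice[f fP] : forall N, exists m, (N <= m)%N /\
    forall k, (N <= k)%N -> (a m <= a k)%N.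
  move=> N; pose P x := `[< exists2 m, (N <= m)%N & a m = x >].
  have exP : exists x, P x by exists (a N); apply/asboolP; exists N.
  case: (ex_minnP exP) => x /asboolP[m Nm <-] min_x; exists m; split=> // k Nk.
  by apply: min_x; apply/asboolP; exists k.
have f_le N : (N <= f N)%N by have [] := fP N.
have f_min N k : (N <= k)%N -> (a (f N) <= a k)%N by have [_] := fP N; apply.
(* [s] picks minima of successive tails of [a] *)
pose s := fix s k := if k is k'.+1 then f (s k').+1 else f 0%N.
have s_min i k : (s i <= k)%N -> (a (s i) <= a k)%N.
  by case: i => [|i] /= sk; apply: f_min; apply: leq_trans sk; apply: f_le.
exists s; apply: (@homo_ltn _ s (fun x y => (x < y)%N && (a x <= a y)%N)).
- move=> y x z /andP[xy axy] /andP[yz ayz].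
  by rewrite (ltn_trans xy yz) (leq_trans axy ayz).
- by move=> i; rewrite /= f_le s_min // ltnW ?f_le.
Qed.

(** Dickson's lemma in its sequence form: nondecreasing subsequences are extracted
    one coordinate after the other. *)
Lemma dickson (I : finType) (h : nat -> I -> nat) :
  exists i j, (i < j)%N /\ forall k, (h i k <= h j k)%N.
Proof.
suff [s sP] : exists s : nat -> nat, forall i j, (i < j)%N ->
    (s i < s j)%N /\ forall k, k \in enum I -> (h (s i) k <= h (s j) k)%N.
  have [s01 hs] := sP 0%N 1%N isT; exists (s 0%N), (s 1%N); split=> // k.
  by apply: hs; rewrite mem_enum.
elim: (enum I) => [|x e [s sP]]; first by exists id.
have [t tP] := nondecreasing_subseq (fun i => h (s i) x).
exists (s \o t) => i j /tP/andP[/sP[st hst] htx]; split=> //= k.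
by rewrite inE => /orP[/eqP ->|/hst].
Qed.

Section LatticeOrder.
Variables (R : realType) (d n : nat) (A : 'M[int]_(d, n)) (w : 'cV[R]_n).
Local Notation C := (R[i]).
Variable lam : 'cV[C]_n.
Local Notation Lam := [set lam + intvec R u | u in latL A].
Local Notation N u := (nsupp (lam + intvec R u)).
Implicit Types (u v : 'cV[int]_n) (I J : {set 'I_n}).

Definition weight u : R := \sum_(j < n) w j 0 * (u j 0)%:~R.

Lemma weightD u v : weight (u + v) = weight u + weight v.
Proof.
rewrite /weight -big_split /=; apply: eq_bigr => j _.
by rewrite mxE rmorphD mulrDr.
Qed.

Lemma weightN u : weight (- u) = - weight u.
Proof.
rewrite /weight -sumrN; apply: eq_bigr => j _.
by rewrite mxE rmorphN mulrN.
Qed.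

Lemma weightB u v : weight (u - v) = weight u - weight v.
Proof. by rewrite weightD weightN. Qed.

Lemma weightMn u k : weight (u *+ k) = weight u *+ k.
Proof.
elim: k => [|k IHk]; last by rewrite !mulrS weightD IHk.
by rewrite !mulr0n /weight big1 // => j _; rewrite mxE mulr0.
Qed.

Lemma wdot_intvec u : wdot w (intvec R u) = (weight u)%:C.
Proof.
rewrite /wdot /weight rmorph_sum /=; apply: eq_bigr => j _.
by rewrite rmorphM /= intvecE rmorph_int.
Qed.

Lemma wleE u v :
  wle w (lam + intvec R u) (lam + intvec R v) <-> weight u <= weight v.
Proof.
rewrite /wle opprD addrACA subrr add0r -intvecN -intvecD wdot_intvec weightB.
by rewrite (ler0c _) subr_ge0.
Qed.

(** The distance to 0 of an integral coordinate. A non-integral coordinate stays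
    outside the negative support all along the lattice; the default value of
    [xget] gives it height 0, so that it never obstructs a comparison. *)
Definition height j u : nat :=
  absz (xget 0 [set m : int | (lam + intvec R u) j 0 = m%:~R]).

Lemma heightE j u (m : int) :
  (lam + intvec R u) j 0 = m%:~R -> height j u = `|m|%N.
Proof.
rewrite /height => um; case: xgetP => [m' _ /=|/(_ m) //].
by rewrite um => /intr_inj ->.
Qed.

(** If [v] lies in the stratum of [u] and is at least as high in every coordinate,
    going further in the direction [v - u] moves each integral coordinate away
    from the boundary of the stratum. *)
Lemma nsupp_ray u v k : N u = N v -> (forall j, height j u <= height j v)%N ->
  N (u + (v - u) *+ k) = N u.
Proof.
move=> Nuv huv.
have rayE j : (u + (v - u) *+ k) j 0 = u j 0 + (v j 0 - u j 0) *+ k.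
  by rewrite mxE mulmxnE !mxE.
have diffE j (m m' : int) : (lam + intvec R u) j 0 = m%:~R ->
    (lam + intvec R v) j 0 = m'%:~R -> v j 0 - u j 0 = m' - m.
  rewrite mxE intvecE mxE intvecE => um vm.
  apply: (@intr_inj C); rewrite !rmorphB /= -um -vm.
  by rewrite opprD addrACA subrr add0r.
apply/finset.setP => j; case: (boolP (j \in N u)) => juN.
- have jvN : j \in N v by rewrite -Nuv.
  have [m [m0 um]] := nsuppP _ _ juN; have [m' [m'0 vm]] := nsuppP _ _ jvN.
  apply: nsupp_le juN; rewrite rayE gerDl mulrn_wle0 //.
  rewrite (diffE _ _ _ um vm) subr_le0.
  have := huv j; rewrite (heightE um) (heightE vm) -lez_nat !ltz0_abs //.
  by rewrite lerN2.
- apply/negbTE; apply: (contra _ juN) => jN; apply: nsupp_le (jN).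
  have [z [z0 rayz]] := nsuppP _ _ jN; rewrite mxE intvecE in rayz.
  have intE x : (lam + intvec R x) j 0 =
      (z - (u + (v - u) *+ k) j 0 + x j 0)%:~R.
    by rewrite mxE intvecE rmorphD rmorphB /= -rayz addrK.
  have nonneg x m : j \notin N x -> (lam + intvec R x) j 0 = m%:~R -> 0 <= m.
    move=> jxN xm; rewrite leNgt; apply: contra jxN => m0.
    by apply/nsuppP; exists m.
  have jvN : j \notin N v by rewrite -Nuv.
  rewrite rayE lerDl mulrn_wge0 // (diffE _ _ _ (intE u) (intE v)) subr_ge0.
  have := huv j; rewrite (heightE (intE u)) (heightE (intE v)) -lez_nat.
  by rewrite !gez0_abs //; apply: nonneg (intE _).
Qed.

(** Lattice points have real weights, so that boundedness alone does not yield a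
    minimum. A strictly decreasing sequence in the stratum would contain, by
    Dickson's lemma, two terms of comparable heights; the ray through them stays
    in the stratum and its weight tends to minus infinity. *)
Lemma weight_min I (m : R) : NS Lam I ->
  (forall u, latL A u -> N u = I -> m <= weight u) ->
  exists u, [/\ latL A u, N u = I &
    forall v, latL A v -> N v = I -> weight u <= weight v].
Proof.
move=> /NSP[u0 u0L u0I] bounded; apply: contrapT => no_min.
pose S u := latL A u /\ N u = I.
have /choice[f fP] : forall u, exists v, S u -> S v /\ weight v < weight u.
  move=> u; apply: contrapT => no_next; apply: no_min; exists u.
  have Su : S u by apply: contrapT => nSu; apply: no_next; exists u => /nSu.
  case: (Su) => uL uI; split=> // v vL vI; rewrite leNgt; apply/negP => vu.
  by apply: no_next; exists v.
pose s k := iter k f u0.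
have sS k : S (s k) by elim: k => [|k IHk] //; have [] := fP _ IHk.
have s_decr : {homo s : i j / (i < j)%N >-> weight j < weight i}.
  apply: (@homo_ltn _ s (fun x y => weight y < weight x)) => [y x z xy yz|i].
    exact: lt_trans yz xy.
  by have [] := fP _ (sS i).
have [i [j [ij hij]]] := dickson (fun k i => height i (s k)).
have [siL siI] := sS i; have [sjL sjI] := sS j.
pose delta := weight (s i) - weight (s j).
have delta_gt0 : 0 < delta by rewrite subr_gt0 s_decr.
(* far enough along the ray to fall below [m] *)
pose k := Num.bound ((weight (s i) - m) / delta).
have gap_ge0 : 0 <= (weight (s i) - m) / delta.
  by apply: divr_ge0; [rewrite subr_ge0 bounded | exact: ltW].
have := archi_boundP gap_ge0; rewrite -/k ltr_pdivrMr // => kP.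
have := bounded (s i + (s j - s i) *+ k).
rewrite nsupp_ray ?siI ?sjI // weightD weightMn weightB.
move=> /(_ _ erefl); rewrite leNgt => /(_ _)/negP; apply.
  rewrite /latL /= mulmxDr siL add0r.
  have L1 : latL A ((s j - s i) *+ k).
    elim: (k) => [|k' IHk]; first exact: latL0.
    by rewrite mulrS; apply: latLD IHk; apply: latLB.
  exact: L1.
rewrite -[weight (s j) - _]opprB mulNrn -/delta ltrBlDr -ltrBlDl.
by rewrite mulrC mulr_natr in kP.
Qed.

Hypothesis w_generic : generic_dir A w.

Lemma weight_inj u v : latL A u -> latL A v -> weight u = weight v -> u = v.
Proof.
move=> uL vL uv; apply/eqP; rewrite -subr_eq0; apply/negPn/negP => uv0.
have := w_generic (latLB uL vL) uv0.
by rewrite -/(weight _) weightB uv subrr eqxx.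
Qed.

Lemma wle_anti g h : Lam g -> Lam h -> wle w g h -> wle w h g -> g = h.
Proof.
move=> [u uL <-] [v vL <-] /wleE uv /wleE vu; congr (_ + intvec R _).
by apply: weight_inj => //; apply/le_anti; rewrite uv vu.
Qed.

Lemma wle_total g h : Lam g -> Lam h -> wle w g h \/ wle w h g.
Proof.
by move=> [u uL <-] [v vL <-]; rewrite !wleE; apply/orP; apply: le_total.
Qed.

Lemma wle_trans g h k : Lam g -> Lam h -> Lam k ->
  wle w g h -> wle w h k -> wle w g k.
Proof.
by move=> [u uL <-] [v vL <-] [t tL <-]; rewrite !wleE; apply: le_trans.
Qed.

Lemma wmin_eq (X : set 'cV[C]_n) g :
  X `<=` Lam -> is_wmin w X g -> wmin w X = g.
Proof.
move=> XL [Xg gmin]; rewrite /wmin; case: xgetP => [h _ [Xh hmin]|/(_ g)].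
  by apply: wle_anti; [apply: XL|apply: XL|apply: hmin|apply: gmin].
by case; split.
Qed.

Lemma stratum_sub I : stratum Lam I `<=` Lam. Proof. by move=> g []. Qed.

Lemma Bset_vmin I : Bset w Lam I -> is_wmin w (stratum Lam I) (vmin w Lam I).
Proof.
move=> [NSI [_ [[v0 v0L <-] [m mP]]]].
have [|u [uL uI u_min]] := @weight_min I (m + weight v0) NSI.
  move=> u uL uI; rewrite -lerBrDr -weightB -lecR -wdot_intvec.
  have := mP (lam + intvec R u) (conj (ex_intro2 _ _ u uL erefl) uI).
  by rewrite opprD addrACA subrr add0r -intvecN -intvecD.
have umin : is_wmin w (stratum Lam I) (lam + intvec R u).
  split; first by split=> //; exists u.
  by move=> _ [[v vL <-] vI]; apply/wleE/u_min.
by rewrite /vmin (wmin_eq (@stratum_sub I) umin).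
Qed.

Lemma wmin_Bset I g : NS Lam I -> Lam g ->
  (forall h, stratum Lam I h -> wle w g h) -> Bset w Lam I.
Proof.
by move=> NSI gL gmin; split=> //; exists g; split=> //; exists 0 => h /gmin.
Qed.

End LatticeOrder.

(** * Starting exponents *)

Section StartingExponents.
Variables (R : realType) (d n : nat) (A : 'M[int]_(d, n)) (w : 'cV[R]_n).
Local Notation C := (R[i]).
Variables (beta : 'cV[C]_d) (lam : 'cV[C]_n).
Hypothesis lamE : map_mx intr A *m lam = beta.
Hypothesis w_generic : generic_dir A w.
Local Notation Lam := [set lam + intvec R u | u in latL A].
Local Notation N u := (nsupp (lam + intvec R u)).
Implicit Types (I J K : {set 'I_n}) (c : coeff_family R n).

Lemma Aset_Bset I : Aset w Lam I -> Bset w Lam I.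
Proof. by case=> NSI; apply. Qed.

Lemma Aset_vmin I : Aset w Lam I -> is_wmin w (stratum Lam I) (vmin w Lam I).
Proof. by move=> /Aset_Bset; apply: Bset_vmin. Qed.

(** For [J] contained in [I] compatibility reads [c I = dyset (I :\: J) (c J)]. *)
Lemma compatible_upward c I J : compatible A lam c -> NS Lam I -> NS Lam J ->
  J \subset I -> c I <> 0 -> c J <> 0.
Proof.
move=> [_ _ c_pair] NSI NSJ JI cI cJ; apply: cI.
have := c_pair I J NSI NSJ; rewrite cJ /dyset linear0.
have -> : (J :\: I)%SET = finset.set0 by apply/eqP; rewrite finset.setD_eq0.
by rewrite mderivm_mesym1_set0.
Qed.

(** By [compatible_upward], requiring that the strata carrying a nonzero
    coefficient be bounded below already places them in [Aset]. *)
Lemma coeff_dirE c : coeff_dir A w Lam c <->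
  compatible A lam c /\ forall I, NS Lam I -> c I <> 0 -> Bset w Lam I.
Proof.
split=> [[c0 c_dyA c_pair cA]|[[c0 c_dyA c_pair] cB]].
- split=> // I NSI cI; apply: Aset_Bset; apply: contrapT => nA; apply: cI.
  exact: cA.
- split=> // I NSI nA; apply: contrapT => cI; apply: nA; split=> // J NSJ JI.
  by apply: cB => //; apply: compatible_upward JI cI => //; split.
Qed.

Section Support.
Variables (E : 'cV[int]_n -> {mpoly C[n]} -> {mpoly C[n]}).
Hypothesis E_aut : forall u, deriv_aut (E u).
Variables (phi : flog C n) (c : coeff_family R n).
Hypothesis phiL : supp phi `<=` Lam.
Hypothesis phiE : forall u, latL A u -> phi (lam + intvec R u) = E u (c (N u)).

Lemma supp_stratum I g : stratum Lam I g -> (supp phi g <-> c I <> 0).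
Proof.
move=> [[u uL <-] <-]; rewrite /supp /= phiE // deriv_aut_eq0 //.
by split=> /eqP.
Qed.

Lemma suppE g : supp phi g -> stratum Lam (nsupp g) g /\ c (nsupp g) <> 0.
Proof.
move=> gs; have gI : stratum Lam (nsupp g) g by split=> //; apply: phiL.
by split=> //; apply/(supp_stratum gI).
Qed.

Lemma wmin_supp_coeffs g : is_wmin w (supp phi) g -> coeff_dir A w Lam c ->
  [/\ Aset w Lam (nsupp g), vmin w Lam (nsupp g) = g,
      forall J, Aset_lt w Lam (nsupp g) J -> c J = 0 & c (nsupp g) <> 0].
Proof.
move=> [gs g_min] c_dir; have [gI cI] := suppE gs.
have NSg : NS Lam (nsupp g) by exists g.
have Ag : Aset w Lam (nsupp g).
  by apply: contrapT => nA; apply: cI; case: c_dir => _ _ _; apply.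
have vg : vmin w Lam (nsupp g) = g.
  apply: (wmin_eq w_generic); first exact: stratum_sub.
  by split=> // h hI; apply: g_min; apply/(supp_stratum hI).
split=> // J [AJ]; rewrite vg => -[vJ_le vJ_neq].
have [vJ _] := Aset_vmin AJ; apply: contrapT => cJ; apply: vJ_neq.
apply: (@wle_anti _ _ _ A w lam w_generic) => //.
- by case: vJ.
- by case: gI.
- by apply: g_min; apply/(supp_stratum vJ).
Qed.

Lemma coeffs_wmin_supp K : Aset w Lam K -> coeff_dir A w Lam c ->
  (forall J, Aset_lt w Lam K J -> c J = 0) -> c K <> 0 ->
  is_wmin w (supp phi) (vmin w Lam K).
Proof.
move=> AK c_dir c_lt cK; have [vK _] := Aset_vmin AK.
split=> [|g gs]; first by apply/(supp_stratum vK).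
have [gI cg] := suppE gs.
have Ag : Aset w Lam (nsupp g).
  apply: contrapT => nA; apply: cg; case: c_dir => _ _ _; apply=> //.
  by exists g.
have [vg vg_min] := Aset_vmin Ag.
have [vKL vgL gL] : [/\ Lam (vmin w Lam K), Lam (vmin w Lam (nsupp g)) & Lam g].
  by split; [case: vK | case: vg | case: gI].
apply: (@wle_trans _ _ _ A w lam _ (vmin w Lam (nsupp g))) => //;
  last exact: vg_min.
have [//|g_le] := wle_total w vKL vgL.
have [->|neq] := pselect (vmin w Lam (nsupp g) = vmin w Lam K).
  by case: vKL => u _ <-; apply/wleE.
by case: cg; apply: c_lt.
Qed.

End Support.

(** The starting exponent determines [K] as its negative support; conversely the
    series built from [c] starts at [vmin w Lam K], because the strata met by its
    support have their minima at or above it. *)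
Lemma RexpP g : Rexp A w beta Lam g <-> exists K c,
  [/\ Aset w Lam K, vmin w Lam K = g, coeff_dir A w Lam c,
      forall J, Aset_lt w Lam K J -> c J = 0 & c K <> 0].
Proof.
have [E EP] := gamma_family lam.
have E_aut u : deriv_aut (E u) by have [] := EP u.
split=> [[phi [[_ phiL ann phi_min] phi_neq0] <-]|
         [K [c [AK <- c_dir c_lt cK]]]].
- have [//|[v v_min]] := phi_min.
  have [c [c_comp phiE]] := coeffs_of_solution lamE EP phiL ann.
  have c_dir : coeff_dir A w Lam c.
    apply/coeff_dirE; split=> // I NSI cI.
    have [vs v_le] := v_min; apply: (wmin_Bset NSI (phiL _ vs)) => h hI.
    by apply: v_le; apply/(supp_stratum E_aut phiE hI).
  have [AK vK c_lt cK] := wmin_supp_coeffs E_aut phiL phiE v_min c_dir.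
  exists (nsupp v), c; split=> //; rewrite vK.
  by rewrite /lexp (wmin_eq w_generic phiL v_min).
- have [c_comp _] := (coeff_dirE c).1 c_dir.
  have [phi [phiL ann phiE]] := solution_of_coeffs lamE EP c_comp.
  have v_min := coeffs_wmin_supp E_aut phiL phiE AK c_dir c_lt cK.
  exists phi; last by rewrite /lexp (wmin_eq w_generic phiL v_min).
  split; last first.
    by move=> phi0; case: v_min; rewrite phi0 /supp /= eqxx.
  split=> //; last by right; exists (vmin w Lam K).
  move=> h /phiL hL; exists h, 0; split=> //.
  by rewrite /intvec map_mx0 addr0.
Qed.

Lemma nsupp_vmin K : Aset w Lam K -> nsupp (vmin w Lam K) = K.
Proof. by move=> /Aset_vmin[[]]. Qed.

Lemma ker_projP K : (exists c, [/\ coeff_dir A w Lam c,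
    forall J, Aset_lt w Lam K J -> c J = 0 & c K <> 0]) <->
  ~ (ker_proj_lt A w Lam K `<=` ker_proj_at A w Lam K).
Proof.
split=> [[c [c_dir c_lt cK]] kerS|].
- have [|_ //] := kerS c; split=> //; apply: funext => J.
  by rewrite /proj_lt /patch; case: ifP => // /set_mem; apply: c_lt.
- move=> /existsNP[c /not_implyP[[c_dir c0] c_at]]; exists c; split=> //.
  + move=> J JK; have := congr1 (fun f : coeff_family R n => f J) c0.
    by rewrite /proj_lt /patch mem_set.
  + by move=> cK; apply: c_at.
Qed.

End StartingExponents.

Theorem theorem6p4 (R : realType) (d n : nat) (A : 'M[int]_(d, n))
    (rankA : \rank (map_mx intr A : 'M[rat]_(d, n)) = d)
    (beta : 'cV[R[i]]_d) (w : 'cV[R]_n) (w_generic : generic_dir A w)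
    (Lam : set 'cV[R[i]]_n) (Lam_lattice : exponent_lattice A beta Lam) :
  (forall K : {set 'I_n}, Aset w Lam K ->
     (Rexp A w beta Lam (vmin w Lam K) <->
      exists c : coeff_family R n,
        [/\ coeff_dir A w Lam c,
            forall J, Aset_lt w Lam K J -> c J = 0 &
            c K <> 0]) /\
     ((exists c : coeff_family R n,
        [/\ coeff_dir A w Lam c,
            forall J, Aset_lt w Lam K J -> c J = 0 &
            c K <> 0]) <->
      ~ (ker_proj_lt A w Lam K `<=` ker_proj_at A w Lam K))) /\
  Rexp A w beta Lam =
    [set vmin w Lam K | K in
       [set K | Aset w Lam K /\
                ~ (ker_proj_lt A w Lam K `<=` ker_proj_at A w Lam K)]].
Proof.
case: Lam_lattice => lam [lamE ->]; split=> [K AK|].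
- split; last exact: ker_projP.
  split=> [/(RexpP lamE w_generic)[K' [c [AK' vK' c_dir c_lt cK]]]|].
    have <- : K' = K.
      by rewrite -(nsupp_vmin w_generic AK') vK' (nsupp_vmin w_generic AK).
    by exists c.
  by case=> c [c_dir c_lt cK]; apply/(RexpP lamE w_generic); exists K, c.
- apply/seteqP; split=> g.
    move=> /(RexpP lamE w_generic)[K [c [AK <- c_dir c_lt cK]]].
    by exists K => //; split=> //; apply/ker_projP; exists c.
  case=> K [AK /ker_projP[c [c_dir c_lt cK]]] <-.
  by apply/(RexpP lamE w_generic); exists K, c.
Qed.
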